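(* Let $F$ be any finite non-trivial group. Then the group $G=F\wr\mathbb{Z}^2$ acts properly, preserving factors, on a product of four trees, but $G$ does not act properly on any finite product of locally finite trees.
   Context: $F\wr\mathbb{Z}^2$ denotes the restricted wreath product $\left(\bigoplus_{(i,j)\in\mathbb{Z}^2}F_{i,j}\right)\rtimes\mathbb{Z}^2$, where each $F_{i,j}$ is a copy of $F$ and $\mathbb{Z}^2$ acts by translating indices. All trees are simplicial trees, regarded as metric spaces with each edge of length 1. A tree is locally finite if every vertex has finite valence. A finite product $P=T_1\times\dots\times T_n$ of trees carries its natural cube complex structure (and the $\ell_2$ product metric). An action of a group $G$ on $P$ is a homomorphism from $G$ to the group $\mathrm{Aut}(P)$ of automorphisms of the cube complex $P$; it may permute factors, may invert edges, and need not be faithful. The action preserves factors if its image lies in $\mathrm{Aut}(T_1)\times\dots\times \mathrm{Aut}(T_n)$, where $\mathrm{Aut}(T_i)$ is the group of simplicial automorphisms of $T_i$. The action is proper if the stabiliser in $G$ of every vertex of $P$ is a finite group. *)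

(* Defs.v *)
From HB Require Import structures.
From mathcomp Require Import all_boot all_algebra all_fingroup finmap.
From mathcomp Require Import boolp classical_sets functions cardinality.

Set Implicit Arguments.
Unset Strict Implicit.
Unset Printing Implicit Defensive.

Import GRing.Theory.

Local Open Scope classical_set_scope.

Section RestrictedWreathProduct.
Local Open Scope group_scope.
Variables (F : groupType) (A : zmodType).

Record wreath : Type :=
  Wreath { lamps : {fsfun A -> F with 1}; shift : A }.

Definition wreath_to_pair (u : wreath) := (lamps u, shift u).
Definition wreath_of_pair p := Wreath p.1 p.2.

Lemma wreath_to_pairK : cancel wreath_to_pair wreath_of_pair.
Proof. by case. Qed.

HB.instance Definition _ := Choice.copy wreath (can_type wreath_to_pairK).

Lemma wreathP (u v : wreath) :
  lamps u =1 lamps v -> shift u = shift v -> u = v.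
Proof. by case: u v => [f a] [g b] /= /fsfunP -> ->. Qed.

Definition wreath_one : wreath := Wreath [fsfun with 1] 0%R.

(* (f, a) * (g, b) = (f . a(g), a + b), where a(g) x = g (x - a). *)
Definition wreath_mul (u v : wreath) : wreath :=
  Wreath
    [fsfun x in (finsupp (lamps u) `|`
                 [fset (y + shift u)%R | y in finsupp (lamps v)])%fset
       => lamps u x * lamps v (x - shift u)%R | 1]
    (shift u + shift v)%R.

Definition wreath_inv (u : wreath) : wreath :=
  Wreath
    [fsfun x in [fset (y - shift u)%R | y in finsupp (lamps u)]%fset
       => (lamps u (x + shift u)%R)^-1 | 1]
    (- shift u)%R.

Lemma lamps_one x : lamps wreath_one x = 1.
Proof. exact: fsfun0E. Qed.

Lemma lamps_mul u v x :
  lamps (wreath_mul u v) x = lamps u x * lamps v (x - shift u)%R.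
Proof.
rewrite fsfun_fun; case: ifPn => //.
rewrite inE negb_or => /andP[fx gx]; rewrite (fsfun_dflt fx) mul1g.
rewrite fsfun_dflt //; apply: contra gx => gx.
by apply/imfsetP; exists (x - shift u)%R => //; rewrite subrK.
Qed.

Lemma lamps_inv u x :
  lamps (wreath_inv u) x = (lamps u (x + shift u)%R)^-1.
Proof.
rewrite fsfun_fun; case: ifPn => // fx.
rewrite fsfun_dflt ?invg1 //; apply: contra fx => fx.
by apply/imfsetP; exists (x + shift u)%R => //; rewrite addrK.
Qed.

Lemma wreath_mulA : associative wreath_mul.
Proof.
move=> u v w; apply: wreathP => [x|]; last exact: addrA.
by rewrite !lamps_mul /= mulgA opprD addrA.
Qed.

Lemma wreath_mul1w : left_id wreath_one wreath_mul.
Proof.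
move=> u; apply: wreathP => [x|]; last exact: add0r.
by rewrite lamps_mul lamps_one mul1g subr0.
Qed.

Lemma wreath_mulw1 : right_id wreath_one wreath_mul.
Proof.
move=> u; apply: wreathP => [x|]; last exact: addr0.
by rewrite lamps_mul lamps_one mulg1.
Qed.

Lemma wreath_mulVw : left_inverse wreath_one wreath_inv wreath_mul.
Proof.
move=> u; apply: wreathP => [x|]; last exact: addNr.
by rewrite lamps_mul lamps_inv lamps_one opprK mulVg.
Qed.

Lemma wreath_mulwV : right_inverse wreath_one wreath_inv wreath_mul.
Proof.
move=> u; apply: wreathP => [x|]; last exact: subrr.
by rewrite lamps_mul lamps_inv lamps_one subrK mulgV.
Qed.

HB.instance Definition _ := isGroup.Build wreath
  wreath_mulA wreath_mul1w wreath_mulw1 wreath_mulVw wreath_mulwV.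

End RestrictedWreathProduct.

Record tree : Type := Tree {
  vert :> eqType;
  adj : rel vert;
  adj_sym : symmetric adj;
  adj_irr : irreflexive adj;
  tree_nonempty : inhabited vert;
  tree_connected : forall x y : vert, exists2 p, path adj x p & last x p = y;
  tree_acyclic : forall c : seq vert, ucycle adj c -> (size c <= 2)%N
}.

Definition locally_finite (T : tree) : Prop :=
  forall x : T, finite_set [set y : T | adj x y].

Definition tree_automorphism (T : tree) (f : T -> T) : Prop :=
  bijective f /\ forall x y : T, adj (f x) (f y) = adj x y.

Definition simplex (T : tree) (A : set T) : Prop :=
  (exists x : T, A = [set x]) \/ (exists x y : T, adj x y /\ A = [set x; y]).

Section ProductOfTrees.
Variables (n : nat) (T : 'I_n -> tree).

Definition prod_vertex : Type := forall i : 'I_n, T i.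

(* A cube of the product is a product of simplices of the factors.  Cubes are
   identified with their vertex sets, and an automorphism of the cube complex
   with the bijection it induces on vertices.  This loses nothing: distinct cubes
   have distinct vertex sets. *)
Definition cube (C : set prod_vertex) : Prop :=
  exists S : forall i : 'I_n, set (T i),
    (forall i, simplex (S i)) /\ C = [set x | forall i, S i (x i)].

Definition cube_automorphism (f : prod_vertex -> prod_vertex) : Prop :=
  bijective f /\ forall C : set prod_vertex, cube (f @` C) <-> cube C.

Variable G : groupType.

Definition acts_on_product (a : G -> prod_vertex -> prod_vertex) : Prop :=
  [/\ forall g, cube_automorphism (a g),
      forall x, a 1%g x = x
    & forall g h x, a (g * h)%g x = a g (a h x)].

Definition preserves_factors (a : G -> prod_vertex -> prod_vertex) : Prop :=
  forall g, exists f : forall i : 'I_n, T i -> T i,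
    (forall i, tree_automorphism (f i)) /\
    (forall x i, a g x i = f i (x i)).

Definition acts_properly (a : G -> prod_vertex -> prod_vertex) : Prop :=
  forall x, finite_set [set g : G | a g x = x].

End ProductOfTrees.

(* Main.v *)
(* The group acts on the tree of each of the four height functions x, -x, y, -y on
   Z^2: a vertex at level k is a coset of the lamp configurations supported on
   heights >= k, and its parent, at level k - 1, is the coset containing it.  An
   element fixing a vertex in each of the four trees has no translation part, and
   its lamps lie in a box.

   On locally finite trees, let K be the finite-index normal subgroup of elements
   that preserve each factor.  The distance between orbit points in a tree is an
   invariant 0-hyperbolic pseudometric on K, so the displacements of commuting
   elements of finite order satisfy |gh| <= max (|g|, |h|), while finite generation
   and local finiteness give at most exponentially many orbit points in a ball.
   K contains a commutator of a lamp with a translation; R^2 of its conjugates by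
   translations of norm O(R) commute and have disjoint supports.  The 2^(R^2)
   products of these conjugates displace the base point by only O(R) in each factor,
   so they have exp(O(R)) images, and vertex stabilisers cannot be finite. *)

Require Import Defs.
From mathcomp Require Import all_boot all_order all_algebra all_fingroup finmap.
From mathcomp Require Import boolp classical_sets functions cardinality.
From mathcomp Require Import zify.

Set Implicit Arguments.
Unset Strict Implicit.
Unset Printing Implicit Defensive.

Import Order.TTheory GRing.Theory.

Local Open Scope nat_scope.
Local Open Scope classical_set_scope.

(** * The path metric of a tree *)

Section TreeMetric.
Variable T : tree.
Implicit Types x y z u v r : T.

Definition joined n x y :=
  exists p, [/\ path (@adj T) x p, last x p = y & size p = n].

Lemma joined_ex x y : exists n, `[< joined n x y >].
Proof.
have [p px py] := tree_connected x y.
by exists (size p); apply/asboolP; exists p.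
Qed.

Definition tree_dist x y := ex_minn (joined_ex x y).

Lemma tree_distP x y : joined (tree_dist x y) x y.
Proof. by rewrite /tree_dist; case: ex_minnP => m /asboolP. Qed.

Lemma tree_dist_min n x y : joined n x y -> tree_dist x y <= n.
Proof.
by move=> h; rewrite /tree_dist; case: ex_minnP => m _; apply; apply/asboolP.
Qed.

Lemma joined_trans m n x y z : joined m x y -> joined n y z -> joined (m + n) x z.
Proof.
move=> [p [pp pl ps]] [q [qp ql qs]]; exists (p ++ q).
by rewrite cat_path pp pl qp last_cat pl ql size_cat ps qs.
Qed.

Lemma joined_sym n x y : joined n x y -> joined n y x.
Proof.
move=> [p [pp pl ps]]; exists (rev (belast x p)); split.
- by rewrite -pl rev_path; under eq_path => a b do rewrite adj_sym.
- by case: p {pp ps} pl => //= a p _; rewrite rev_cons last_rcons.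
- by rewrite size_rev size_belast.
Qed.

Lemma tree_dist_sym x y : tree_dist x y = tree_dist y x.
Proof.
by apply/eqP; rewrite eqn_leq !tree_dist_min //; apply/joined_sym/tree_distP.
Qed.

Lemma tree_distxx x : tree_dist x x = 0.
Proof. by apply/eqP; rewrite -leqn0 tree_dist_min //; exists [::]. Qed.

Lemma tree_dist_eq0 x y : tree_dist x y = 0 -> x = y.
Proof. by move=> d0; have := tree_distP x y; rewrite d0 => -[[|? ?] []]. Qed.

Lemma tree_dist_triangle x y z : tree_dist x z <= tree_dist x y + tree_dist y z.
Proof. by apply/tree_dist_min/joined_trans; exact: tree_distP. Qed.

Lemma tree_dist_adj x y : adj x y -> tree_dist x y <= 1.
Proof. by move=> xy; apply: tree_dist_min; exists [:: y]; rewrite /= xy. Qed.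

(** Shortening the path to a simple one and adding [v] closes a cycle. Acyclicity leaves room only
    for [v] and [a], so the shortened path is trivial. *)
Lemma avoiding_path v a b p :
  adj v a -> adj v b -> path (@adj T) a p -> last a p = b -> v \notin a :: p ->
  a = b.
Proof.
move=> va vb pp pl vp; case/shortenP: pp pl => q pq uq sq ql.
have vq : v \notin a :: q.
  by apply: contra vp; rewrite !inE => /orP[->//|/sq ->]; rewrite orbT.
have : ucycle (@adj T) [:: v, a & q].
  apply/andP; split; last by rewrite cons_uniq vq.
  by rewrite /= rcons_path va pq ql adj_sym vb.
by move=> /tree_acyclic; case: q ql {pq uq sq vq}.
Qed.

(** * Levels, parents and ancestors in a rooted tree *)

Section Rooted.
Variable r : T.
Local Notation lev := (tree_dist r).

Lemma descent v : exists p,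
  [/\ path (@adj T) v p, last v p = r & all (fun u => lev u < lev v) p].
Proof.
have [p [pp pl ps]] := tree_distP v r; exists p; split => //.
apply/allP => u up; case/splitPr: up pp pl ps => p1 p2.
rewrite cat_path last_cat size_cat /= => /and3P[_ _ p2p] p2l ps.
have : tree_dist u r <= size p2 by apply: tree_dist_min; exists p2.
by rewrite tree_dist_sym [lev v]tree_dist_sym -ps; lia.
Qed.

(* The two descents to [r] join [u] to [a] avoiding [v]. *)
Lemma lower_neighbour_uniq v u a :
  adj v u -> adj v a -> u != v -> lev u <= lev v -> lev a < lev v -> u = a.
Proof.
move=> vu va uv lu la.
have [p [pp pl pa]] := descent u; have [q [qp ql qa]] := descent a.
have [q' [q'p q'l q'a]] : exists q', [/\ path (@adj T) r q', last r q' = a &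
    all (fun w => lev w < lev v) q'].
  exists (rev (belast a q)); split.
  - by rewrite -ql rev_path; under eq_path => x y do rewrite adj_sym.
  - by case: q {qp qa} ql => //= x q _; rewrite rev_cons last_rcons.
  - rewrite all_rev; apply/allP => w /mem_belast; rewrite inE => /predU1P[->//|].
    by move=> /(allP qa) wa; apply: ltn_trans la.
apply: (@avoiding_path v u a (p ++ q')) => //.
- by rewrite cat_path pp pl.
- by rewrite last_cat pl.
- rewrite inE mem_cat !negb_or eq_sym uv /=; apply/andP; split; apply/negP.
    by move=> /(allP pa); lia.
  by move=> /(allP q'a); lia.
Qed.

Lemma lower_neighbour v : v != r -> exists2 u, adj v u & lev v = (lev u).+1.
Proof.
move=> vr; have [[|u p] [pp pl ps]] := tree_distP v r.
  by move: vr; rewrite -pl eqxx.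
move: pp => /= /andP[vu pp]; exists u => //.
have : tree_dist u r <= size p by apply: tree_dist_min; exists p.
have := tree_dist_triangle v u r; have := tree_dist_adj vu.
rewrite ![tree_dist r _]tree_dist_sym -ps/=; lia.
Qed.

(** The default branch is taken only at the root, which is its own parent. *)
Definition parent v :=
  if pselect (exists2 u, adj v u & lev v = (lev u).+1) is left h
  then projT1 (cid2 h) else v.

Lemma parentP v : v != r -> adj v (parent v) /\ lev v = (lev (parent v)).+1.
Proof.
by rewrite /parent => /lower_neighbour vr; case: pselect => // h; case: cid2.
Qed.

(** The endpoint of larger or equal level is not the root, and [lower_neighbour_uniq] identifies the
    other endpoint with its parent. This also excludes edges between vertices of equal level. *)
Lemma adj_parent u v : adj u v ->
  (lev u = (lev v).+1 /\ v = parent u) \/ (lev v = (lev u).+1 /\ u = parent v).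
Proof.
have neq x y : adj x y -> x != y.
  by apply: contraTneq => ->; rewrite adj_irr.
have aux x y : adj x y -> lev y <= lev x ->
    lev x = (lev y).+1 /\ y = parent x.
  move=> xy lyx; have xr : x != r.
    apply/eqP => xr; move: lyx; rewrite xr tree_distxx leqn0 => /eqP.
    by move/tree_dist_eq0 => ry; move: (neq _ _ xy); rewrite xr ry eqxx.
  have [xp lp] := parentP xr.
  have yp : y = parent x.
    apply: (@lower_neighbour_uniq x) => //; last by rewrite lp.
    by rewrite eq_sym neq.
  by rewrite yp.
move=> uv; case: (leqP (lev v) (lev u)) => [/(aux _ _ uv)|/ltnW luv]; first by left.
by right; apply: aux => //; rewrite adj_sym.
Qed.

(** For [k > lev v] the truncated subtraction gives [v] itself, which is why [meet_at] bounds
    [k]. *)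
Definition ancestor k v := iter (lev v - k) parent v.

Lemma iter_parent j v : j <= lev v ->
  lev (iter j parent v) = lev v - j /\ joined j v (iter j parent v).
Proof.
elim: j => [|j IH] jv /=; first by rewrite subn0; split=> //; exists [::].
have [lj jj] := IH (ltnW jv); set w := iter _ _ _ in lj jj *.
have /parentP[wp lw] : w != r.
  by apply: contraTneq jv => wr; move: lj; rewrite wr tree_distxx; lia.
split; first by lia.
by rewrite -addn1; apply: joined_trans jj _; exists [:: parent w]; rewrite /= wp.
Qed.

Lemma ancestor_ancestor k l v : k <= l -> l <= lev v ->
  ancestor k (ancestor l v) = ancestor k v.
Proof.
move=> kl lv; rewrite /ancestor (iter_parent _).1 ?leq_subr// -iterD.
by congr iter; lia.
Qed.

(** The largest such [k] is the Gromov product of [u] and [v] at [r]. *)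
Definition meet_at k u v :=
  [/\ k <= lev u, k <= lev v & ancestor k u = ancestor k v].

Lemma meet_at_down k l u v : l <= k -> meet_at k u v -> meet_at l u v.
Proof.
move=> lk [ku kv e]; split; try lia.
by rewrite -(ancestor_ancestor lk ku) e ancestor_ancestor.
Qed.

Lemma meet_at_upper k u v : meet_at k u v -> tree_dist u v + k.*2 <= lev u + lev v.
Proof.
move=> [ku kv e]; have [_ ju] := iter_parent (leq_subr k (lev u)).
have [_ jv] := iter_parent (leq_subr k (lev v)).
have := tree_dist_min (joined_trans ju _); rewrite -/(ancestor k u) e.
by move=> /(_ _ v (joined_sym jv)); lia.
Qed.

(** Induction along a walk from [u], with its length in place of the distance. A step to a child
    keeps the meeting level; a step to a parent lowers it by at most one, and only when the walk was
    at the meeting vertex. *)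
Lemma meet_at_lower u v : exists2 k, meet_at k u v &
  lev u + lev v <= tree_dist u v + k.*2.
Proof.
have [p [pp pl <-]] := tree_distP u v.
elim/last_ind: p v pp pl => [v _ /= <-|p w IH v].
  by exists (lev u) => //; lia.
rewrite rcons_path last_rcons size_rcons => /andP[pp pw] <-.
have [k kk lk] := IH _ pp erefl; set x := last u p in pw kk lk.
case: (adj_parent pw) => -[lx ex].
- case: (leqP k (lev w)) => kw.
    exists k; last by lia.
    case: kk => ku kx e; split => //; rewrite e /ancestor lx subSn //.
    by rewrite iterSr -ex.
  exists (lev w); last by case: kk; lia.
  have [wu wx e] : meet_at (lev w) u x by apply: meet_at_down kk; lia.
  by split => //; rewrite e /ancestor lx subSnn subnn /= -ex.
- exists k; last by lia.
  case: kk => ku kx e; split => //; first by lia.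
  by rewrite e /ancestor lx subSn// iterSr -ex.
Qed.

End Rooted.

(* With the root at [r], Gromov products count common ancestors, and a common
   ancestor of [x], [z] and one of [z], [y] are comparable. *)
Lemma tree_dist_four x y z r :
  tree_dist x y + tree_dist z r <=
  maxn (tree_dist x z + tree_dist y r) (tree_dist y z + tree_dist x r).
Proof.
have [k kk lk] := meet_at_lower r x z; have [l ll_ ll] := meet_at_lower r y z.
have [l1 l2 le] := meet_at_down (geq_minr k l) ll_.
have [k1 k2 ke] := meet_at_down (geq_minl k l) kk.
have := @meet_at_upper r (minn k l) x y; rewrite /meet_at ke le.
move=> /(_ (And3 k1 l1 erefl)); rewrite ![tree_dist _ r]tree_dist_sym.
lia.
Qed.

Lemma finite_ball x n : locally_finite T ->
  finite_set [set y | tree_dist x y <= n].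
Proof.
move=> lfT; elim: n => [|n IH].
  apply: (@sub_finite_set _ _ [set x]); last exact: finite_set1.
  by move=> y; rewrite /= leqn0 => /eqP/tree_dist_eq0.
apply: (@sub_finite_set _ _ ([set x] `|`
    \bigcup_(z in [set z | tree_dist x z <= n]) [set y | adj z y])).
  move=> y /= xy; have [->|yx] := eqVneq y x; [by left|right].
  have [u uy lu] := lower_neighbour yx.
  by exists u => /=; [lia|rewrite adj_sym].
by rewrite finite_setU; split; [exact: finite_set1|apply: bigcup_finite].
Qed.

End TreeMetric.

(** * Groups with invariant 0-hyperbolic pseudometrics *)

Definition subgroup (G : groupType) (K : G -> Prop) : Prop :=
  [/\ K 1%g, forall g h, K g -> K h -> K (g * h)%g & forall g, K g -> K g^-1%g].

Inductive generated_by (G : groupType) (S : seq G) : G -> Prop :=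
| generated1 : generated_by S 1%g
| generatedMr g s : generated_by S g -> s \in S -> generated_by S (g * s)%g.

Lemma generatedM (G : groupType) (S : seq G) g h :
  generated_by S g -> generated_by S h -> generated_by S (g * h)%g.
Proof.
move=> Sg; elim=> [|{}h s _ IH Ss]; first by rewrite mulg1.
by rewrite mulgA; apply: generatedMr.
Qed.

Lemma generated_mem (G : groupType) (S : seq G) s : s \in S -> generated_by S s.
Proof. by move=> ?; rewrite -[s]mul1g; apply: generatedMr => //; constructor. Qed.

Lemma generatedX (G : groupType) (S : seq G) g n :
  generated_by S g -> generated_by S (g ^+ n)%g.
Proof.
move=> Sg; elim: n => [|n IH]; first exact: generated1.
by rewrite expgS; apply: generatedM.
Qed.

(** Distance 0 between distinct elements is allowed, since [d] will be a tree metric pulled back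
    along an orbit map. Invariance is asked of [K] only, because other elements may permute the
    factors. *)
Record hyperbolic (G : groupType) (K : G -> Prop) (d : G -> G -> nat) : Prop := {
  hyp_xx : forall x, d x x = 0;
  hyp_sym : forall x y, d x y = d y x;
  hyp_four : forall x y z w,
    d x y + d z w <= maxn (d x z + d y w) (d y z + d x w);
  hyp_inv : forall g x y, K g -> d (g * x)%g (g * y)%g = d x y
}.

(** Balls are counted up to distance 0: the stabiliser of a vertex of a single factor may be
    infinite, so a ball of [K] itself may be too. *)
Definition locally_finite_metric (G : groupType) (K : G -> Prop)
    (d : G -> G -> nat) : Prop :=
  forall m, exists2 W : seq G, forall w, w \in W -> K w &
    forall g, K g -> d 1%g g <= m -> exists2 w, w \in W & d w g = 0.

Section Hyperbolic.
Variables (G : groupType) (K : G -> Prop) (d : G -> G -> nat).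
Hypotheses (sgK : subgroup K) (hd : hyperbolic K d).
Local Notation len g := (d 1%g g).
Implicit Types g h : G.

Lemma subgroup1 : K 1%g. Proof. by case: sgK. Qed.
Lemma subgroupM g h : K g -> K h -> K (g * h)%g.
Proof. by case: sgK => _ KM _; apply: KM. Qed.
Lemma subgroupV g : K g -> K g^-1%g.
Proof. by case: sgK => _ _; apply. Qed.
Lemma subgroupX g n : K g -> K (g ^+ n)%g.
Proof.
move=> Kg; elim: n => [|n IH]; first exact: subgroup1.
by rewrite expgS; apply: subgroupM.
Qed.

Lemma hyp_triangle x y z : d x z <= d x y + d y z.
Proof. by have := hyp_four hd x z y y; rewrite (hyp_xx hd) (hyp_sym hd z y); lia. Qed.

Lemma hyp_dist g x : K g -> d g x = len (g^-1 * x)%g.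
Proof. by move=> Kg; rewrite -(hyp_inv hd g x (subgroupV Kg)) mulVg. Qed.

Lemma lenV g : K g -> len g^-1%g = len g.
Proof. by move=> Kg; rewrite -[g^-1%g]mulg1 -hyp_dist// (hyp_sym hd). Qed.

Lemma lenM g h : K g -> len (g * h)%g <= len g + len h.
Proof.
move=> Kg; apply: leq_trans (hyp_triangle 1%g g _) _.
by rewrite leq_add2l hyp_dist// mulKg.
Qed.

Lemma lenX g n : K g -> len (g ^+ n)%g <= n * len g.
Proof.
move=> Kg; elim: n => [|n IH]; first by rewrite expg0 (hyp_xx hd).
by rewrite expgS mulSn (leq_trans (lenM _ Kg))// leq_add2l.
Qed.

(* If [len (g ^+ 2) > len g], then the four point condition makes
   [n |-> len (g ^+ n)] convex and increasing. *)
Lemma len_square_torsion g m : K g -> 0 < m -> (g ^+ m = 1)%g ->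
  len (g ^+ 2)%g <= len g.
Proof.
move=> Kg m0 gm1; rewrite leqNgt; apply/negP => lt12.
have incr n : 0 < n -> len (g ^+ n)%g < len (g ^+ n.+1)%g /\
    len g < len (g ^+ n.+1)%g.
  have dX i j : d (g ^+ i)%g (g ^+ (i + j))%g = len (g ^+ j)%g.
    by rewrite hyp_dist; [rewrite expgnDr mulKg|exact: subgroupX].
  elim: n => [//|[|n] IH] _; first by rewrite expg1.
  have [lt1 lt2] := IH isT.
  have := hyp_four hd 1%g (g ^+ n.+2)%g (g ^+ n.+3)%g (g ^+ 1)%g.
  rewrite (hyp_sym hd (g ^+ n.+3)%g) (hyp_sym hd _ (g ^+ 1)%g).
  have -> : d (g ^+ 1)%g (g ^+ n.+3)%g = len (g ^+ n.+2)%g by exact: (dX 1).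
  have -> : d (g ^+ 1)%g (g ^+ n.+2)%g = len (g ^+ n.+1)%g by exact: (dX 1).
  have -> : d (g ^+ n.+2)%g (g ^+ n.+3)%g = len g.
    by rewrite -[in RHS](expg1 g) -(dX n.+2) addn1.
  by rewrite expg1; lia.
by have [_] := incr m m0; rewrite expgS gm1 mulg1 ltnn.
Qed.

(** The four point condition for 1, [g], [h], [g * h] bounds [len (g * h) + d g h] by twice [len g].
    For [g^-1], [h], [g], 1 it bounds [len (g * h)] by the larger of [len g] and [d g h]. The two
    bounds combine. *)
Lemma len_mul_commute g h : K g -> K h -> commute g h ->
  len (g ^+ 2)%g <= len g -> len h <= len g -> len (g * h)%g <= len g.
Proof.
move=> Kg Kh gh g2 hg.
have d1 : d g (g * h)%g = len h by rewrite hyp_dist// mulKg.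
have d2 : d h (g * h)%g = len g by rewrite gh hyp_dist// mulKg.
have KgV := subgroupV Kg.
have d3 : d g^-1%g h = len (g * h)%g by rewrite hyp_dist// invgK.
have d4 : d g^-1%g g = len (g ^+ 2)%g by rewrite hyp_dist// invgK expg2.
have := hyp_four hd g h (g * h)%g 1%g; have := hyp_four hd g^-1%g h g 1%g.
rewrite !(hyp_sym hd _ 1%g) d1 d2 d3 d4 lenV// (hyp_sym hd h); lia.
Qed.

(** This ultrametric bound keeps a product of arbitrarily many commuting torsion elements as short
    as its longest factor. *)
Lemma len_mul_torsion g h m : K g -> K h -> commute g h -> 0 < m ->
  (g ^+ m = 1)%g -> (h ^+ m = 1)%g -> len (g * h)%g <= maxn (len g) (len h).
Proof.
move=> Kg Kh gh m0 gm hm; case: (leqP (len h) (len g)) => hg.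
  exact: len_mul_commute (len_square_torsion Kg m0 gm) hg.
rewrite gh; apply: len_mul_commute (ltnW hg) => //.
exact: len_square_torsion Kh m0 hm.
Qed.

(** * Exponential bound on the number of orbit points in a ball *)

Section Growth.
Variables (S : seq G) (C : nat).
Hypotheses (SK : forall s, s \in S -> K s) (SC : forall s, s \in S -> len s <= C).

Lemma generated_sub g : generated_by S g -> K g.
Proof.
elim=> [|{}g s _ Kg Ss]; first exact: subgroup1.
by apply: subgroupM => //; exact: SK.
Qed.

Lemma generated_crossing (P : pred G) g : generated_by S g -> ~~ P 1%g -> P g ->
  exists y s, [/\ generated_by S y, s \in S, ~~ P y & P (y * s)%g].
Proof.
move=> Sg P1; elim: Sg => [|{}g s Sg IH Ss] Pg; first by rewrite Pg in P1.
by case: (boolP (P g)) => [/IH//|nPg]; exists g, s.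
Qed.

(* A chain of orbit points from 1 to [g] with steps at most [C] passes within
   [C] of the point of the geodesic at distance [C.+1] from [g]. *)
Lemma generated_backwards g : generated_by S g -> 0 < len g ->
  exists h, [/\ generated_by S h, len h < len g & d h g <= C.*2.+1].
Proof.
move=> Sg g0; case: (leqP (len g) C.+1) => gC.
  by exists 1%g; split; [exact: generated1|rewrite (hyp_xx hd)|lia].
(* [P y] says that the Gromov product of [y] and [g] at 1 is at least [len g - C.+1]. It fails at 1
   and holds at [g], so a word for [g] crosses into [P]. *)
pose P y := (len g - C.+1).*2 + d y g <= len y + len g.
have [||y [s [Sy Ss nPy Pys]]] := generated_crossing (P := P) Sg.
- by rewrite /P (hyp_xx hd); lia.
- by rewrite /P (hyp_xx hd); lia.
exists (y * s)%g; have Ky := generated_sub Sy.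
have ys : d y (y * s)%g <= C by rewrite hyp_dist// mulKg SC.
have := hyp_four hd y g (y * s)%g 1%g.
have := hyp_triangle 1%g y (y * s)%g.
rewrite !(hyp_sym hd _ 1%g) (hyp_sym hd g).
move: nPy Pys; rewrite /P => nPy Pys tri four.
by split; [exact: generatedMr|lia|lia].
Qed.

(** By [generated_backwards], a point at radius [r.+1] is one bounded jump away from a point within
    radius [r]. Translated back to 1, the jump is represented in a list [W] independent of [r], so
    each unit of radius multiplies the count by at most [size W]. *)
Lemma exponential_growth : locally_finite_metric K d ->
  exists k, forall r, exists E : seq G, [/\ size E <= k ^ r,
    forall e, e \in E -> K e &
    forall g, generated_by S g -> len g <= r -> exists2 e, e \in E & d e g = 0].
Proof.
move=> /(_ C.*2.+1)[W WK Wc]; exists (size W); elim=> [|r [E [sE EK Ec]]].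
  exists [:: 1%g]; split=> [//|e|g Sg]; first by rewrite inE => /eqP->; exact: subgroup1.
  by rewrite leqn0 => /eqP g0; exists 1%g; rewrite ?inE.
exists [seq e * w | e <- E, w <- W]%g; split.
- by rewrite size_allpairs expnSr leq_mul.
- by move=> _ /allpairsP[[e w] [/= /EK Ke /WK Kw ->]]; exact: subgroupM.
move=> g Sg gr.
have [h [Sh hr hg]] : exists h, [/\ generated_by S h, len h <= r & d h g <= C.*2.+1].
  case: (posnP (len g)) => [g0|/(generated_backwards Sg)[h [Sh hg hgC]]].
    by exists g; rewrite g0 (hyp_xx hd).
  by exists h; split => //; lia.
have [e Ee eh] := Ec _ Sh hr; have Ke := EK _ Ee.
have [] := Wc (e^-1 * g)%g.
- by apply: subgroupM; [exact: subgroupV|exact: generated_sub].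
- by rewrite -hyp_dist//; have := hyp_triangle e h g; lia.
move=> w Ww wg; exists (e * w)%g; first by apply/allpairsP; exists (e, w).
by rewrite -[g](mulVKg e) (hyp_inv hd).
Qed.

End Growth.

End Hyperbolic.

Lemma leq_expl e m n : m <= n -> m ^ e <= n ^ e.
Proof. by case: e => // e; rewrite leq_exp2r. Qed.

(** Compares exponents of 2 in [exponential_count]: orbit points on the left, subsets of the grid on
    the right. *)
Lemma quadratic_not_linear (A B C R : nat) : R = (A * C).*2 + B + 1 ->
  A * (C * R + C) + B < R * R.
Proof. by move=> ->; nia. Qed.

(** Pigeonhole. Each set [s] is sent to representatives, one per factor, of the orbit point of
    [b R s]; there are at most [k ^ (r * n)] such tuples, with [r] linear in [R]. Elements with
    equal tuples differ by a member of [Q], so the subsets of the grid would inject into too small a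
    set. *)
Lemma exponential_count (G : groupType) (K : G -> Prop) (n : nat)
    (d : 'I_n -> G -> G -> nat) (Q S : seq G) (C : nat)
    (b : forall R, {set 'I_R * 'I_R} -> G) :
  subgroup K -> (forall i, hyperbolic K (d i)) ->
  (forall i, locally_finite_metric K (d i)) ->
  (forall g, K g -> (forall i, d i 1%g g = 0) -> g \in Q) ->
  (forall s, s \in S -> K s) ->
  (forall R, injective (b R)) ->
  (forall R s, generated_by S (b R s)) ->
  (forall R s i, d i 1%g (b R s) <= C * R + C) -> False.
Proof.
move=> sgK hd lfd Qs SK binj bS bC.
have [D SD] : exists D, forall i s, s \in S -> d i 1%g s <= D.
  exists (\max_i \max_(s <- S) d i 1%g s) => i s Ss.
  apply: leq_trans (leq_bigmax i).
  by elim: S Ss {SK bS} => // x S' IH; rewrite inE big_cons => /predU1P[->|/IH]; lia.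
have [k0 kP0] := choice (fun i => exponential_growth sgK (hd i) SK (SD i) (lfd i)).
pose k := \max_i k0 i.
have kP i r : exists E : seq G, [/\ size E <= k ^ r, forall e, e \in E -> K e &
    forall g, generated_by S g -> d i 1%g g <= r -> exists2 e, e \in E & d i e g = 0].
  have [E [sE EK Ec]] := kP0 i r; exists E; split => //.
  by apply: leq_trans sE (leq_expl _ _); exact: leq_bigmax.
(* The value required by [quadratic_not_linear] with [A = k * n] and [B = size Q]. *)
pose R := (k * n * C).*2 + size Q + 1; pose r := C * R + C.
have [E EP] := choice (fun i => kP i r).
have fex s : exists h : {ffun 'I_n -> 'I_(k ^ r)},
    forall i, d i (nth 1%g (E i) (h i)) (b R s) = 0.
  have [i|h hP] := choice (fun i => _ : exists j : 'I_(k ^ r),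
      d i (nth 1%g (E i) j) (b R s) = 0).
    have [sE EK Ec] := EP i; have [e Ee eb] := Ec _ (bS R s) (bC R s i).
    have lt : index e (E i) < k ^ r by apply: leq_trans sE; rewrite index_mem.
    by exists (Ordinal lt); rewrite nth_index.
  by exists (finfun h) => i; rewrite ffunE.
have [f fP] := choice fex.
have bK s : K (b R s) by apply: (generated_sub sgK SK).
have sameQ s t : f s = f t -> ((b R s)^-1 * b R t)%g \in Q.
  move=> fst; apply: Qs; first by apply: subgroupM => //; exact: subgroupV.
  move=> i; rewrite -(hyp_dist sgK (hd i)) //; apply/eqP; rewrite -leqn0.
  have := hyp_triangle (hd i) (b R s) (nth 1%g (E i) (f s i)) (b R t).
  by rewrite (hyp_sym (hd i) (b R s) (nth _ _ _)) fP fst fP.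
(* One chosen set in each fibre of [f]; the default is never reached at values of [f]. An index in
   [Q] then locates [s] within its fibre. *)
pose rep u := odflt finset.set0 [pick s | f s == u].
have repP s : f (rep (f s)) = f s.
  by rewrite /rep; case: pickP => [t /eqP//|/(_ s)]; rewrite eqxx.
have lt s : index ((b R (rep (f s)))^-1 * b R s)%g Q < size Q.
  by rewrite index_mem sameQ.
pose F s := (f s, Ordinal (lt s)).
have Finj : injective F.
  move=> s t [fst] /(congr1 (nth 1%g Q)); rewrite !nth_index ?sameQ// fst.
  by move/mulgI/binj.
have := leq_card F Finj.
rewrite card_prod card_ffun !card_ord -cardsT -powersetT card_powerset cardsT.
rewrite card_prod !card_ord; apply/negP; rewrite -ltnNge.
(* Bounding [k] by [2 ^ k] and [size Q] by [2 ^ size Q] reduces everything to powers of 2. *)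
apply: leq_ltn_trans (_ : 2 ^ (k * n * r + size Q) < _).
  rewrite expnD leq_mul ?(ltnW (ltn_expl _ _))// -expnM.
  have -> : k * n * r = k * (r * n) by lia.
  by rewrite [leqRHS]expnM leq_expl// ltnW// ltn_expl.
by rewrite ltn_exp2l// quadratic_not_linear.
Qed.

(** * Automorphisms of a product of trees permute the directions *)

Section Directions.
Variables (n : nat) (T : 'I_n -> tree).
Local Notation P := (prod_vertex T).
Implicit Types x y z w : P.

Lemma prod_vertexP x y : (forall i, x i = y i) -> x = y.
Proof. exact: functional_extensionality_dep. Qed.

Definition edge_along (i : 'I_n) x y : Prop :=
  adj (x i) (y i) /\ forall j, j != i -> x j = y j.

Definition edge x y : Prop := exists i, edge_along i x y.

Lemma adj_neq (S : tree) (u v : S) : adj u v -> u <> v.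
Proof. by move=> uv e; move: uv; rewrite e adj_irr. Qed.

Lemma edge_along_sym i x y : edge_along i x y -> edge_along i y x.
Proof. by move=> [xy e]; rewrite /edge_along adj_sym; split=> // j /e. Qed.

Lemma edge_along_inj i j x y : edge_along i x y -> edge_along j x y -> i = j.
Proof.
move=> [/adj_neq xy _] [_ e]; apply/eqP/contraT => ij.
by case: xy; exact: e.
Qed.

(** Edges are the cubes with two vertices, which makes them visible to cube automorphisms. *)
Lemma edge_cube x y : edge x y <-> x <> y /\ cube [set x; y].
Proof.
split=> [[i [xy e]]|[xy [S [Ssim SE]]]].
  split; first by move=> xy'; apply: (adj_neq xy); rewrite xy'.
  exists (fun j => [set x j; y j]); split.
    move=> j; have [->|ji] := eqVneq j i; first by right; exists (x i), (y i).
    by left; exists (x j); rewrite -e// setUid.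
  apply/seteqP; split=> z /=; first by move=> [->|->] j; [left|right].
  move=> zxy; have zj j : j != i -> z j = x j 
    by move=> /e xyj; case: (zxy j); rewrite xyj.
  case: (zxy i) => zi; [left|right]; apply: prod_vertexP => j;
    by have [->|ji] := eqVneq j i => //; rewrite zj// e.
have Sx : [set x; y] x by left.
have Sy : [set x; y] y by right.
rewrite SE/= in Sx; rewrite SE/= in Sy.
have [i xyi] : exists i, x i <> y i.
  by apply: contrapT => /forallNP h; apply: xy; apply: prod_vertexP => i; apply: contrapT.
exists i; split.
  case: (Ssim i) => [[u e]|[u [v [uv e]]]]; move: (Sx i) (Sy i); rewrite e/=.
    by move=> xu yu; case: xyi; rewrite xu yu.
  by move=> [xu|xv] [yu|yv]; rewrite ?xu ?xv ?yu ?yv ?[adj v u]adj_sym//;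
    case: xyi; congruence.
move=> j ji; apply: contrapT => xyj.
(* If [x] and [y] also differed at [j], changing only coordinate [i] would give a third vertex of
   the cube. *)
have : [set x; y] (dfwith x (y i)).
  by rewrite SE => l /=; case: dfwithP => [|k _]; [exact: Sy|exact: Sx].
move=> [/(congr1 (fun z : P => z i))|/(congr1 (fun z : P => z j))].
  by rewrite dfwith_in => /esym.
by rewrite dfwith_out// eq_sym.
Qed.

Lemma cube_automorphism_edge (f : P -> P) x y : cube_automorphism f ->
  edge (f x) (f y) <-> edge x y.
Proof.
move=> [bf fc]; have fi := bij_inj bf; rewrite !edge_cube.
have <- : f @` [set x; y] = [set f x; f y] by rewrite image_setU !image_set1.
by rewrite fc; split=> -[xy c]; split=> // e; apply: xy; [rewrite e|exact: fi].
Qed.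

(* Directions can be read off the edge graph: two edges at a vertex have different
   directions iff they span a square. *)
Lemma square_directions i j x y z w : edge_along i x y -> edge_along j x z ->
  y <> z -> w <> x -> edge y w -> edge z w -> i <> j.
Proof.
move=> [xyi xy] [xzi xz] yz wx [k [ywk yw]] [l [zwl zw]] ij; subst j.
have yzi : y i <> z i.
  move=> e; apply: yz; apply: prod_vertexP => j.
  by have [->//|ji] := eqVneq j i; rewrite -xy// xz.
have ki : k = i.
  apply/eqP/contraT => ki.
  have wi : w i = y i by rewrite yw// eq_sym.
  have li : l = i.
    by apply/eqP/contraT => li; case: yzi; rewrite -wi -zw// eq_sym.
  by move: ywk; rewrite -zw ?li// -xz// xy// adj_irr.
have li : l = i.
  apply/eqP/contraT => li.
  have wi : w i = z i by rewrite zw// eq_sym.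
  by move: zwl; rewrite -yw ?ki// -xy// xz// adj_irr.
subst k l; apply: wx; apply: prod_vertexP => j.
have [->|ji] := eqVneq j i; last by rewrite xy// yw.
apply/eqP/contraT => wxi.
(* Otherwise [y i], [w i], [z i] is a path avoiding [x i] between two distinct neighbours of
   [x i]. *)
case: yzi; apply: (@avoiding_path _ (x i) _ _ [:: w i; z i]) => //.
  by rewrite /= ywk [adj (w i) _]adj_sym zwl.
rewrite !inE !negb_or eq_sym [x i == w i]eq_sym wxi.
apply/and3P; split=> //; apply/eqP => e.
- by move: xyi; rewrite e adj_irr.
- by move: xzi; rewrite e adj_irr.
Qed.

Lemma square_of_directions i j x y z : edge_along i x y -> edge_along j x z ->
  i <> j -> exists w, [/\ w <> x, edge y w & edge z w].
Proof.
move=> [xyi xy] [xzj xz] /eqP ij; have ji : j != i by rewrite eq_sym.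
exists (dfwith y (z j)); split.
- move=> /(congr1 (fun z : P => z i)); rewrite dfwith_out// => e.
  by move: xyi; rewrite e adj_irr.
- exists j; split; first by rewrite dfwith_in -xy.
  by move=> k kj; rewrite dfwith_out// eq_sym.
- exists i; split; first by rewrite dfwith_out// -xz.
  move=> k ki; have [->|kj] := eqVneq k j; first by rewrite dfwith_in.
  by rewrite dfwith_out 1?eq_sym// -xz// xy.
Qed.

(** Otherwise [w i = x i], so the edge from [y] to [w] merely undoes the one from [x] to [y], and
    [w = x]. *)
Lemma square_opposite i j x y z w : edge_along i x y -> edge_along j x z ->
  i <> j -> w <> x -> edge y w -> edge z w -> edge_along i z w.
Proof.
move=> [xyi xy] [xzj xz] /eqP ij wx [k [ywk yw]] [l [zwl zw]].
have ji : j != i by rewrite eq_sym.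
suff -> : i = l by [].
apply/esym/eqP/contraT => li.
have wi : w i = x i by rewrite -zw 1?eq_sym// -xz.
have ki : k = i.
  apply/eqP/contraT => ki.
  by move: xyi; rewrite -wi yw ?adj_irr// eq_sym.
subst k; have lj : l = j.
  apply/eqP/contraT => lj.
  by move: xzj; rewrite xy// yw// zw ?adj_irr// eq_sym.
subst l; case: wx; apply: prod_vertexP => k.
by have [->//|ki] := eqVneq k i; rewrite -yw// xy.
Qed.

(** The finitely many coordinates are changed one after another, each along a path in its tree. *)
Lemma prod_connected (Q : P -> Prop) x :
  (forall y z, edge y z -> Q y -> Q z) -> Q x -> forall y, Q y.
Proof.
move=> Qe Qx y.
have Qi z i (v : T i) : Q z -> Q (dfwith z v).
  have [p zp <-] := tree_connected (z i) v.
  elim: p z zp => [|u p IH] z /=.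
    move=> _ Qz; suff -> : dfwith z (z i) = z by [].
    by apply: prod_vertexP => j; case: dfwithP.
  move=> /andP[zu up] Qz.
  have Qu : Q (dfwith z u).
    apply: Qe Qz; exists i; split; first by rewrite dfwith_in.
    by move=> j ji; rewrite dfwith_out// eq_sym.
  have := IH (dfwith z u); rewrite dfwith_in => /(_ up Qu).
  congr Q; apply: prod_vertexP => j.
  have [->|ji] := eqVneq j i; first by rewrite !dfwith_in.
  by rewrite !dfwith_out// eq_sym.
have [z Qz zy] : exists2 z, Q z & forall i, i \in enum 'I_n -> z i = y i.
  elim: (enum _) => [|i s [z Qz zy]]; first by exists x.
  exists (dfwith z (y i)); first exact: Qi.
  move=> j; rewrite inE; have [->|ji] := eqVneq j i; first by rewrite dfwith_in.
  by rewrite dfwith_out 1?eq_sym//; exact: zy.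
suff <- : z = y by [].
by apply: prod_vertexP => i; apply: zy; rewrite mem_enum.
Qed.

Section EdgePreserving.
Variable f : P -> P.
Hypotheses (bf : bijective f) (fE : forall x y, edge (f x) (f y) <-> edge x y).

(** Images with different directions would span a square; its preimage would be a square spanned by
    two edges of the same direction. *)
Lemma same_direction_at i j x y y' : edge_along i x y -> edge_along i x y' ->
  edge_along j (f x) (f y) -> edge_along j (f x) (f y').
Proof.
move=> xy xy' fxy; have [<-//|/eqP yy'] := eqVneq y y'.
have [j' fxy'] : edge (f x) (f y') by apply/fE; exists i.
have [->//|/eqP jj'] := eqVneq j j'.
have [w [wx yw y'w]] := square_of_directions fxy fxy' jj'.
have [g fK gK] := bf; rewrite -(gK w) in yw y'w.
have gwx : g w <> x by move=> e; apply: wx; rewrite -e gK.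
by have := square_directions xy xy' yy' gwx ((fE _ _).1 yw) ((fE _ _).1 y'w).
Qed.

(** The direction [j] found at one vertex propagates along edges. Across an edge of direction [i]
    this is [same_direction_at]; across any other edge, the two [i]-edges are opposite sides of a
    square. *)
Lemma edge_along_image i : exists j, forall x y,
  edge_along i x y -> edge_along j (f x) (f y).
Proof.
have [[x0 [y0 xy0]]|noedge] := pselect (exists x y, edge_along i x y); last first.
  by exists i => x y xy; case: noedge; exists x, y.
have [j fxy0] : edge (f x0) (f y0) by apply/fE; exists i.
pose Q x := forall y, edge_along i x y -> edge_along j (f x) (f y).
exists j; apply: (prod_connected (Q := Q) (x := x0)); last first.
  by move=> y xy; exact: same_direction_at xy0 xy fxy0.
move=> x x' [l xx'] IH y' xy'.
have [li|/eqP li] := eqVneq l i.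
  subst l; apply: (same_direction_at (edge_along_sym xx') xy').
  by apply: edge_along_sym; exact: IH.
(* The fourth corner of the square on [x], [x'], [y']. *)
pose y := dfwith y' (x l).
have xy : edge_along i x y.
  case: xx' xy' => _ xx' [xyi xy']; have il : i != l by apply/eqP => /esym.
  split=> [|k ki]; first by rewrite /y dfwith_out 1?eq_sym// xx'.
  have [->|kl] := eqVneq k l; first by rewrite /y dfwith_in.
  by rewrite /y dfwith_out 1?eq_sym// xx'// xy'.
have [m fxx'] : edge (f x) (f x') by apply/fE; exists l.
have yy' : edge (f y) (f y').
  apply/fE; exists l; split=> [|k kl]; last by rewrite /y dfwith_out// eq_sym.
  rewrite /y dfwith_in; case: xx' xy' => xx' _ [_ xy'].
  by rewrite -xy'//; apply/eqP.
have fx'y' : edge (f x') (f y') by apply/fE; exists i.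
have y'x : f y' <> f x.
  move=> /(bij_inj bf) e; subst y'; apply: li; apply: edge_along_inj xx' _.
  exact: edge_along_sym.
apply: (square_opposite (IH _ xy) fxx' _ y'x yy' fx'y').
apply: (square_directions (IH _ xy) fxx' _ y'x yy' fx'y').
move=> /(bij_inj bf) e; apply: li; apply: edge_along_inj xx' _.
by rewrite -e.
Qed.

End EdgePreserving.

Definition direction_preserving (f : P -> P) : Prop :=
  forall i x y, edge_along i x y -> edge_along i (f x) (f y).

(** Walk from [x] to [y] with coordinate [i] frozen at [x i]: no edge crossed has direction [i], so
    coordinate [i] of the image never changes. *)
Lemma direction_preserving_coord f i x y : direction_preserving f ->
  x i = y i -> f x i = f y i.
Proof.
move=> df xy.
have := @prod_connected (fun z => f (dfwith z (x i)) i = f x i) x _ _ y.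
have -> : dfwith y (x i) = y by rewrite xy; apply: prod_vertexP => j; case: dfwithP.
move=> H; apply/esym/H.
  move=> z z' [l zz']; have [li|li] := eqVneq l i.
    subst l; suff -> : dfwith z (x i) = dfwith z' (x i) by [].
    apply: prod_vertexP => j; have [->|ji] := eqVneq j i; first by rewrite !dfwith_in.
    by rewrite !dfwith_out 1?eq_sym//; case: zz' => _ ->.
  have : edge_along l (dfwith z (x i)) (dfwith z' (x i)).
    case: zz' => zzl zz'; split; first by rewrite !dfwith_out 1?eq_sym.
    move=> k kl; have [->|ki] := eqVneq k i; first by rewrite !dfwith_in.
    by rewrite !dfwith_out 1?eq_sym// zz'.
  by move=> /df [_ e]; rewrite e// eq_sym.
by congr (f _ i); apply: prod_vertexP => j; case: dfwithP.
Qed.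

(** By the previous lemma [f] induces a map of the factor [T i], which sends edges to edges and
    hence paths to paths of the same length. *)
Lemma direction_preserving_dist f i x y : direction_preserving f ->
  tree_dist (f x i) (f y i) <= tree_dist (x i) (y i).
Proof.
move=> df; pose g (u : T i) := f (dfwith x u) i.
have gE z : f z i = g (z i).
  by apply: direction_preserving_coord => //; rewrite dfwith_in.
rewrite !gE; have [p [pp pl <-]] := tree_distP (x i) (y i).
apply: tree_dist_min; exists (map g p); split; last by rewrite size_map.
  apply: homo_path pp => u v uv.
  have [] : edge_along i (f (dfwith x u)) (f (dfwith x v)); last by [].
  apply: df; split; first by rewrite !dfwith_in.
  by move=> j ji; rewrite !dfwith_out// eq_sym.
by rewrite last_map pl.
Qed.

End Directions.

(** * The finite-index normal subgroup preserving each factor, and its orbit metrics *)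

Section DirectionSubgroup.
Variables (n : nat) (T : 'I_n -> tree) (G : groupType).
Variable a : G -> prod_vertex T -> prod_vertex T.
Hypothesis act : acts_on_product a.

Lemma act1 x : a 1%g x = x. Proof. by case: act. Qed.
Lemma actM g h x : a (g * h)%g x = a g (a h x). Proof. by case: act. Qed.
Lemma actK g x : a g^-1%g (a g x) = x. Proof. by rewrite -actM mulVg act1. Qed.
Lemma actVK g x : a g (a g^-1%g x) = x. Proof. by rewrite -actM mulgV act1. Qed.

Lemma act_edge g x y : edge (a g x) (a g y) <-> edge x y.
Proof. by apply: cube_automorphism_edge; case: act. Qed.

Lemma act_edge_along g i : exists j, forall x y,
  edge_along i x y -> edge_along j (a g x) (a g y).
Proof.
apply: edge_along_image => [|x y]; last exact: act_edge.
by case: act => /(_ g)[].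
Qed.

Definition dir_kernel (g : G) : Prop := direction_preserving (a g).

Lemma dir_kernel_subgroup : subgroup dir_kernel.
Proof.
split=> [i x y|g h Kg Kh i x y xy|g Kg i x y xy]; first by rewrite !act1.
  by rewrite !actM; apply/Kg/Kh.
have [j gj] := act_edge_along g^-1%g i; have xy' := gj _ _ xy.
have := Kg _ _ _ xy'; rewrite !actVK => /(edge_along_inj xy) ij.
by rewrite -ij in xy'.
Qed.

Lemma dir_kernel_conj g k : dir_kernel k -> dir_kernel (g * k * g^-1)%g.
Proof.
move=> Kk i x y xy; have [j gj] := act_edge_along g^-1%g i.
have [l gl] := act_edge_along g j; have := gl _ _ (gj _ _ xy).
rewrite !actVK => /(edge_along_inj xy) il; subst l.
by rewrite !actM; apply/gl/Kk/gj.
Qed.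

(** The finitely many values of [c] bound the index. [c] is only a choice of directions: on a factor
    without edges its value is arbitrary. *)
Lemma dir_kernel_finite_index :
  exists c : G -> {ffun 'I_n -> 'I_n}, forall g h, c g = c h -> dir_kernel (g^-1 * h)%g.
Proof.
have cP g : exists s : {ffun 'I_n -> 'I_n}, forall i x y,
    edge_along i x y -> edge_along (s i) (a g x) (a g y).
  have [s sP] := choice (act_edge_along g).
  by exists (finfun s) => i x y; rewrite ffunE; exact: sP.
have [c {}cP] := choice cP; exists c => g h cgh i x y xy.
have [l gl] := act_edge_along g^-1%g (c g i).
have := gl _ _ (cP g _ _ _ xy); rewrite !actK => /(edge_along_inj xy) il; subst l.
by rewrite !actM; apply: gl; rewrite cgh; exact: cP.
Qed.

Lemma dir_kernel_power g : exists2 N, 0 < N & dir_kernel (g ^+ N)%g.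
Proof.
have [c cP] := dir_kernel_finite_index.
pose F (k : 'I_(#|{ffun 'I_n -> 'I_n}|.+1)) := c (g ^+ k)%g.
have /injectivePn[k [l kl Fkl]] : ~~ injectiveb F.
  by apply/negP => /injectiveP/leq_card; rewrite card_ord ltnn.
wlog kl' : k l kl Fkl / k < l.
  move=> wl; case: (ltngtP k l) => [|lk|/val_inj e]; first exact: wl.
    by apply: (wl l k) => //; rewrite eq_sym.
  by rewrite e eqxx in kl.
exists (l - k); first by rewrite subn_gt0.
have := cP _ _ Fkl; rewrite -{1}(subnKC (ltnW kl')) expgnDr mulKg.
by [].
Qed.

Variable x0 : prod_vertex T.

Definition orbit_dist i g h := tree_dist (a g x0 i) (a h x0 i).

Lemma orbit_dist_hyperbolic i : hyperbolic dir_kernel (orbit_dist i).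
Proof.
split=> [g|g h|g h k l|g x y Kg]; rewrite /orbit_dist.
- exact: tree_distxx.
- exact: tree_dist_sym.
- exact: tree_dist_four.
apply/eqP; rewrite eqn_leq !actM direction_preserving_dist//=.
have [_ _ KV] := dir_kernel_subgroup.
have := direction_preserving_dist i (a g (a x x0)) (a g (a y x0)) (KV _ Kg).
by rewrite !actK.
Qed.

Lemma orbit_dist_locally_finite i : locally_finite (T i) ->
  locally_finite_metric dir_kernel (orbit_dist i).
Proof.
move=> lfT m.
have /finite_seqP[s sE] := finite_ball (x0 i) m lfT.
have [K1 _ _] := dir_kernel_subgroup.
(* One element of the kernel for each vertex [v] that its orbit reaches in factor [i]; elsewhere 1
   is a placeholder. *)
have rP v : exists g, dir_kernel g /\
    ((exists h, dir_kernel h /\ a h x0 i = v) -> a g x0 i = v).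
  have [[h [Kh hv]]|no] := pselect (exists h, dir_kernel h /\ a h x0 i = v).
    by exists h.
  by exists 1%g; split=> // /no.
have [r {}rP] := choice rP; exists (map r s).
  by move=> _ /mapP[v _ ->]; case: (rP v).
move=> g Kg; rewrite /orbit_dist act1 => gm.
have gs : a g x0 i \in s by have : [set` s] (a g x0 i) by rewrite -sE.
exists (r (a g x0 i)); first exact: map_f.
have [_ ->] := rP (a g x0 i); first exact: tree_distxx.
by exists g.
Qed.

Lemma orbit_dist_eq0 g : (forall i, orbit_dist i 1%g g = 0) -> a g x0 = x0.
Proof.
move=> g0; apply: prod_vertexP => i; have := g0 i; rewrite /orbit_dist act1.
by move/tree_dist_eq0.
Qed.

End DirectionSubgroup.

(** * No proper action on a product of locally finite trees *)

Section WreathLaws.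
Variables (F : groupType) (A : zmodType).
Implicit Types u v : wreath F A.

Lemma lampsM u v x : lamps (u * v)%g x = (lamps u x * lamps v (x - shift u)%R)%g.
Proof. exact: lamps_mul. Qed.

Lemma lampsV u x : lamps u^-1%g x = (lamps u (x + shift u)%R)^-1%g.
Proof. exact: lamps_inv. Qed.

Lemma lamps_id x : lamps (1%g : wreath F A) x = 1%g.
Proof. exact: lamps_one. Qed.

Lemma shiftM u v : shift (u * v)%g = (shift u + shift v)%R.
Proof. by []. Qed.

Lemma shiftV u : shift u^-1%g = (- shift u)%R.
Proof. by []. Qed.

End WreathLaws.

Lemma int_pairMn (x y : int) n : ((x, y) *+ n = (x * Posz n, y * Posz n))%R.
Proof.
elim: n => [|n IH]; first by rewrite mulr0n !mulr0.
by rewrite mulrS IH; congr pair => /=; lia.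
Qed.

Section WreathElements.
Variables (F : finGroupType) (f : F).
Local Notation G := (wreath F (int * int)%type).
Implicit Types u v : G.

Definition translation (c : int * int) : G := Wreath [fsfun with 1%g] c.

Definition lamp0 : G := Wreath [fsfun x in [fset (0 : int * int)%R]%fset => f | 1%g] 0%R.

Lemma lamps_lamp0 x : lamps lamp0 x = if x == 0%R then f else 1%g.
Proof. by rewrite fsfun_fun inE. Qed.

Lemma translationD c e : (translation c * translation e)%g = translation (c + e)%R.
Proof. by apply: wreathP => // x; rewrite lampsM /= !fsfun0E mulg1. Qed.

Lemma translationX c n : (translation c ^+ n)%g = translation (c *+ n)%R.
Proof.
elim: n => [|n IH]; first by rewrite expg0 mulr0n.
by rewrite expgS IH translationD mulrS.
Qed.

Lemma lamps_translation_conj c u x : shift u = 0%R ->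
  lamps (translation c * u * (translation c)^-1)%g x = lamps u (x - c)%R.
Proof.
move=> u0; rewrite !lampsM lampsV !fsfun0E invg1 mulg1.
by rewrite mul1g.
Qed.

(** Restricting lamps to powers of the single element [f] gives commuting elements of bounded order
    even when [F] is not abelian. *)
Definition lamp_power u : Prop :=
  shift u = 0%R /\ forall x, exists m, lamps u x = (f ^+ m)%g.

Lemma lamp_power1 : lamp_power 1%g.
Proof. by split=> // x; exists 0; rewrite lamps_id. Qed.

Lemma lamp_powerM u v : lamp_power u -> lamp_power v -> lamp_power (u * v)%g.
Proof.
move=> [u0 uf] [v0 vf]; split=> [|x]; first by rewrite shiftM u0 v0 addr0.
have [m um] := uf x; have [k vk] := vf x; exists (m + k).
by rewrite lampsM u0 subr0 um vk expgnDr.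
Qed.

Lemma lamp_powerV u : lamp_power u -> lamp_power u^-1%g.
Proof.
move=> [u0 uf]; split=> [|x]; first by rewrite shiftV u0 oppr0.
have [m um] := uf x; exists (#[f]%g * m - m).
rewrite lampsV u0 addr0 um -[LHS]mulg1 -(expg1n F m) -(expg_order f).
have lem : m <= #[f]%g * m by rewrite leq_pmull// order_gt0.
by rewrite -expgnA -{1}(subnKC lem) expgnDr mulKg.
Qed.

Lemma lamp_power_conj c u : lamp_power u ->
  lamp_power (translation c * u * (translation c)^-1)%g.
Proof.
move=> [u0 uf]; split=> [|x]; last by rewrite lamps_translation_conj.
by rewrite !shiftM shiftV u0 addr0 addrN.
Qed.

Lemma lamp_power_commute u v : lamp_power u -> lamp_power v -> commute u v.
Proof.
move=> [u0 uf] [v0 vf]; apply: wreathP => [x|]; last by rewrite !shiftM u0 v0.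
have [m um] := uf x; have [k vk] := vf x.
by rewrite !lampsM u0 v0 subr0 um vk -!expgnDr addnC.
Qed.

Lemma lamp_power_exponent u : lamp_power u -> (u ^+ #[f]%g = 1)%g.
Proof.
move=> [u0 uf].
have uX n : shift (u ^+ n)%g = 0%R /\ forall x, lamps (u ^+ n)%g x = (lamps u x ^+ n)%g.
  elim: n => [|n [s0 IH]]; first by split=> // x; rewrite lamps_id.
  rewrite expgS; split=> [|x]; first by rewrite shiftM u0 s0 addr0.
  by rewrite lampsM u0 subr0 IH -expgS.
apply: wreathP => [x|]; last by case: (uX #[f]%g).
have [m um] := uf x; rewrite (uX _).2 um lamps_id.
by rewrite -expgnA mulnC expgnA expg_order expg1n.
Qed.

(** * A grid of commuting conjugates of a lamp commutator *)

Section LampGrid.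
Variables N1 N2 : nat.

Definition step1 := translation (Posz N1, 0)%R.
Definition step2 := translation (0, Posz N2)%R.
(* The commutator of a lamp with [step1]: unlike the lamp, it lies in every
   normal subgroup that contains [step1]. *)
Definition lamp_pair := (lamp0 * step1 * lamp0^-1 * step1^-1)%g.
(** The doubling leaves room for the second lamp of [lamp_pair], at distance [N1] from the first. *)
Definition grid_translation (a b : nat) := (step1 ^+ (a.*2) * step2 ^+ b)%g.
Definition grid_point (a b : nat) : int * int := (Posz (N1 * a.*2), Posz (N2 * b)).

Lemma grid_translationE a b : grid_translation a b = translation (grid_point a b).
Proof.
rewrite /grid_translation !translationX translationD; congr translation.
by rewrite !int_pairMn; congr pair => /=; lia.
Qed.

Definition grid_pair (a b : nat) :=
  (grid_translation a b * lamp_pair * (grid_translation a b)^-1)%g.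

Lemma lamp_pairE : lamp_pair = (lamp0 * (step1 * lamp0^-1 * step1^-1))%g.
Proof. by rewrite /lamp_pair !mulgA. Qed.

Lemma lamps_pair x : lamps lamp_pair x =
  ((if x == 0%R then f else 1) * (if (x - (Posz N1, 0))%R == 0%R then f else 1)^-1)%g.
Proof.
rewrite lamp_pairE lampsM (_ : shift lamp0 = 0%R)// subr0.
rewrite lamps_translation_conj// lampsV (_ : shift lamp0 = 0%R)// addr0.
by rewrite !lamps_lamp0.
Qed.

Lemma lamp_power_lamp0 : lamp_power lamp0.
Proof.
split=> // x; rewrite lamps_lamp0.
by case: eqP => _; [exists 1; rewrite expg1|exists 0].
Qed.

Lemma lamp_power_pair : lamp_power lamp_pair.
Proof.
rewrite lamp_pairE; apply: lamp_powerM; first exact: lamp_power_lamp0.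
by apply/lamp_power_conj/lamp_powerV/lamp_power_lamp0.
Qed.

Lemma lamp_power_grid a b : lamp_power (grid_pair a b).
Proof.
rewrite /grid_pair grid_translationE.
by apply/lamp_power_conj/lamp_power_pair.
Qed.

Lemma lamps_grid a b a' b' : 0 < N1 -> 0 < N2 ->
  lamps (grid_pair a b) (grid_point a' b') = if (a == a') && (b == b') then f else 1%g.
Proof.
move=> N1gt0 N2gt0.
rewrite /grid_pair grid_translationE lamps_translation_conj; last first.
  by case: lamp_power_pair.
rewrite lamps_pair.
(* The second lamp of a pair sits at an odd multiple of [N1], hence at no grid point. *)
have -> : (grid_point a' b' - grid_point a b - (Posz N1, 0) == 0)%R = false.
  apply/negP => /eqP/(congr1 fst) /= e.
  have : N1 * a'.*2 = N1 * a.*2.+1 by rewrite mulnS; lia.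
  by move/eqP; rewrite eqn_pmul2l//; lia.
rewrite invg1 mulg1; congr (if _ then _ else _).
apply/eqP/andP => [e|[/eqP-> /eqP->]]; last exact: subrr.
have /= e1 := congr1 fst e; have /= e2 := congr1 snd e.
have : N1 * a.*2 = N1 * a'.*2 by lia.
have : N2 * b = N2 * b' by lia.
by move/eqP; rewrite eqn_pmul2l// => bb' /eqP; rewrite eqn_pmul2l//; lia.
Qed.

Definition grid_element (s : seq (nat * nat)) := (\prod_(z <- s) grid_pair z.1 z.2)%g.

Lemma lamp_power_grid_element s : lamp_power (grid_element s).
Proof.
rewrite /grid_element; elim: s => [|z s IH].
  by rewrite big_nil; exact: lamp_power1.
by rewrite big_cons; apply: lamp_powerM => //; exact: lamp_power_grid.
Qed.

(** Reading the lamps at grid points recovers [s], so distinct sets give distinct elements. *)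
Lemma lamps_grid_element s z : 0 < N1 -> 0 < N2 -> uniq s ->
  lamps (grid_element s) (grid_point z.1 z.2) = if z \in s then f else 1%g.
Proof.
move=> N1gt0 N2gt0; rewrite /grid_element.
elim: s => [|w s IH]; first by rewrite big_nil lamps_id.
rewrite cons_uniq big_cons inE => /andP[ws us].
have [w0 _] := lamp_power_grid w.1 w.2.
rewrite lampsM w0 subr0 IH// lamps_grid// -xpair_eqE -!surjective_pairing [z == w]eq_sym.
by have [<-|] := eqVneq w z; rewrite /= ?(negPf ws) ?mulg1 ?mul1g.
Qed.

Definition grid_generators := [:: step1; step1^-1; step2; step2^-1; lamp_pair]%g.

Lemma generated_grid_element s : generated_by grid_generators (grid_element s).
Proof.
rewrite /grid_element; elim: s => [|z s IH]; first by rewrite big_nil; exact: generated1.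
have mem x : x \in grid_generators -> generated_by grid_generators x.
  exact: generated_mem.
rewrite big_cons; apply: generatedM => //; rewrite /grid_pair /grid_translation.
rewrite invgM -!expVgn; apply: generatedM; [apply: generatedM|];
  first [apply: generatedM; apply: generatedX|idtac];
  by apply: mem; rewrite !inE eqxx ?orbT.
Qed.

Section Length.
Variables (K : G -> Prop) (d : G -> G -> nat).
Hypotheses (sgK : subgroup K) (hd : hyperbolic K d).
Hypotheses (K1 : K step1) (K2 : K step2) (Kl : K lamp_pair).

Lemma grid_pair_kernel a b : K (grid_pair a b).
Proof.
have Kt : K (grid_translation a b) by apply: subgroupM => //; exact: subgroupX.
by apply: subgroupM => //; [apply: subgroupM|apply: subgroupV].
Qed.

(** Conjugation costs twice the length of the translation, which uses at most [2 * R] copies of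
    [step1] and [R] of [step2]. *)
Lemma grid_pair_length a b R : a < R -> b < R ->
  d 1%g (grid_pair a b) <=
  (4 * d 1%g step1 + 2 * d 1%g step2) * R + d 1%g lamp_pair.
Proof.
move=> aR bR.
have Kt : K (grid_translation a b) by apply: subgroupM => //; exact: subgroupX.
have lt : d 1%g (grid_translation a b) <= a.*2 * d 1%g step1 + b * d 1%g step2.
  apply: leq_trans (lenM sgK hd _ _) _; first exact: subgroupX.
  by apply: leq_add; apply: (lenX sgK hd).
have l1 : d 1%g (grid_pair a b) <=
    d 1%g (grid_translation a b * lamp_pair)%g + d 1%g (grid_translation a b).
  by rewrite -(lenV sgK hd Kt) (lenM sgK hd)//; exact: subgroupM.
have l2 : d 1%g (grid_translation a b * lamp_pair)%g <=
    d 1%g (grid_translation a b) + d 1%g lamp_pair by exact: (lenM sgK hd).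
have : a.*2 * d 1%g step1 <= R.*2 * d 1%g step1 by apply: leq_mul => //; lia.
have : b * d 1%g step2 <= R * d 1%g step2 by apply: leq_mul => //; lia.
lia.
Qed.

(** The bound is independent of the size of [s], by [len_mul_torsion]. *)
Lemma grid_element_length D s : (forall z, z \in s -> d 1%g (grid_pair z.1 z.2) <= D) ->
  K (grid_element s) /\ d 1%g (grid_element s) <= D.
Proof.
rewrite /grid_element; elim: s => [|z s IH] sD.
  by rewrite big_nil (hyp_xx hd); split=> //; exact: subgroup1.
have [|Ks ls] := IH; first by move=> w ws; apply: sD; rewrite inE ws orbT.
have Kz := grid_pair_kernel z.1 z.2; rewrite big_cons; split; first exact: subgroupM.
have pz := lamp_power_grid z.1 z.2; have ps := lamp_power_grid_element s.
apply: leq_trans (len_mul_torsion sgK hd Kz Ks _ (order_gt0 f) _ _) _.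
- exact: lamp_power_commute.
- exact: lamp_power_exponent.
- exact: lamp_power_exponent.
by rewrite geq_max ls sD// mem_head.
Qed.

End Length.
End LampGrid.
End WreathElements.

Lemma no_proper_action (F : finGroupType) (f : F) (n : nat) (T : 'I_n -> tree)
    (a : wreath F (int * int)%type -> prod_vertex T -> prod_vertex T) :
  f != 1%g -> (forall i, locally_finite (T i)) ->
  acts_on_product a -> acts_properly a -> False.
Proof.
move=> f1 lfT act prop.
have ex i : exists x : T i, True by case: (tree_nonempty (T i)) => x; exists x.
pose x0 : prod_vertex T := fun i => projT1 (cid (ex i)).
have sgK := dir_kernel_subgroup act.
(* Unit translations may permute factors; suitable powers of them do not. *)
have [N1 N1gt0 K1'] := dir_kernel_power act (translation F (1, 0)%R).
have [N2 N2gt0 K2'] := dir_kernel_power act (translation F (0, 1)%R).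
have K1 : dir_kernel a (step1 F N1).
  by move: K1'; rewrite translationX int_pairMn mul0r mul1r.
have K2 : dir_kernel a (step2 F N2).
  by move: K2'; rewrite translationX int_pairMn mul0r mul1r.
have Kl : dir_kernel a (lamp_pair f N1).
  apply: (subgroupM sgK); last exact: (subgroupV sgK).
  exact: dir_kernel_conj.
pose d i := orbit_dist a x0 i.
have hd i : hyperbolic (dir_kernel a) (d i) by exact: orbit_dist_hyperbolic.
have /finite_seqP[Q QE] := prop x0.
pose c i := 4 * d i 1%g (step1 F N1) + 2 * d i 1%g (step2 F N2)
  + d i 1%g (lamp_pair f N1).
pose pts R (s : {set 'I_R * 'I_R}) : seq (nat * nat) :=
  [seq (nat_of_ord z.1, nat_of_ord z.2) | z <- enum s].
pose b R (s : {set 'I_R * 'I_R}) := grid_element f N1 N2 (pts R s).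
have ptsu R s : uniq (pts R s).
  rewrite map_inj_uniq ?enum_uniq// => -[x y] [x' y'] [/= xx yy].
  by congr pair; apply: val_inj.
apply: (@exponential_count _ (dir_kernel a) n d Q
  (grid_generators f N1 N2) (\max_i c i) b) => //.
- by move=> i; apply: orbit_dist_locally_finite.
- move=> g _ /(orbit_dist_eq0 act) gx; have : [set` Q] g by rewrite -QE.
  by [].
- move=> s; rewrite !inE => /or4P[/eqP->|/eqP->|/eqP->|/orP[/eqP->|/eqP->]] //;
    exact: (subgroupV sgK).
- move=> R s t bst; apply/setP => z.
  have memE (r : {set 'I_R * 'I_R}) :
      ((nat_of_ord z.1, nat_of_ord z.2) \in pts R r) = (z \in r).
    rewrite -(mem_enum r) /pts; apply/mapP/idP => [[[x y] w []]|zr]; last by exists z.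
    by case: z => x' y' /= /val_inj-> /val_inj->.
  pose p := (nat_of_ord z.1, nat_of_ord z.2).
  have := congr1 (fun u => lamps u (grid_point N1 N2 p.1 p.2)) bst.
  rewrite /b !lamps_grid_element// !memE.
  by case: (z \in s); case: (z \in t) => // e; move: f1; rewrite ?e -?e eqxx.
- by move=> R s; exact: generated_grid_element.
- move=> R s i.
  have [|_ //] := @grid_element_length F f N1 N2 _ _ sgK (hd i) K1 K2 Kl
    ((\max_i c i) * R + \max_i c i) (pts R s).
    move=> _ /mapP[z _ ->] /=.
    apply: leq_trans (grid_pair_length sgK (hd i) K1 K2 Kl (ltn_ord z.1) (ltn_ord z.2)) _.
    apply: leq_add; [apply: leq_mul => //|]; apply: leq_trans (leq_bigmax i).
      exact: leq_addr.
    exact: leq_addl.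
Qed.

(** * The action on a product of four trees *)

Section ParentTree.
Variables (V : eqType) (up : V -> V) (level : V -> int) (v0 : V).
Hypothesis level_up : forall v, level (up v) = (level v - 1)%R.
Hypothesis confluent : forall u v, exists m n, iter m up u = iter n up v.

Definition up_adj (u v : V) : bool := (up u == v) || (up v == u).

Lemma up_adj_sym : symmetric up_adj.
Proof. by move=> u v; rewrite /up_adj orbC. Qed.

Lemma up_adj_irr : irreflexive up_adj.
Proof.
move=> u; rewrite /up_adj orbb; apply/eqP => /(congr1 level).
by rewrite level_up; lia.
Qed.

(** Climb from [u] to a common ancestor, then follow the climb from [v] backwards. *)
Lemma up_connected u v : exists2 p, path up_adj u p & last u p = v.
Proof.
have toup w n : path up_adj w (traject up (up w) n).
  by apply: sub_path (fpath_traject _ _ _) => x y /= /eqP <-; rewrite /up_adj eqxx.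
have [m [n e]] := confluent u v.
exists (traject up (up u) m ++ rev (belast v (traject up (up v) n))).
  rewrite cat_path toup last_traject e -(last_traject up v n) rev_path.
  by under eq_path => x y do rewrite up_adj_sym; exact: toup.
rewrite last_cat last_traject e.
by case: n {e} => [|n] //=; rewrite rev_cons last_rcons.
Qed.

(* The two cycle neighbours of a vertex of maximal level are both its parent. *)
Lemma up_acyclic c : ucycle up_adj c -> size c <= 2.
Proof.
case: c => [//|x c]; set c0 := x :: c => cc.
have [v vc vmax] : exists2 v, v \in c0 & forall u, u \in c0 -> (level u <= level v)%R.
  rewrite /c0; elim: c x {c0 cc} => [|y c IH] x.
    by exists x => [|u]; rewrite inE // => /eqP ->.
  have [v vc vmax] := IH y; case: (ltP (level v) (level x)) => vx.
    exists x => [|u]; rewrite inE ?eqxx// => /predU1P[->//|/vmax]; lia.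
  exists v => [|u]; rewrite inE ?vc ?orbT// => /predU1P[->|/vmax]; lia.
have neighbour u : u \in c0 -> up_adj v u -> u = up v.
  move=> /vmax uv /orP[/eqP//|/eqP e]; move: uv; rewrite -e level_up; lia.
have [i s e] := rot_to vc.
rewrite -(size_rot i) e.
have {}cc : ucycle up_adj (v :: s) by rewrite -e rot_ucycle.
have mem u : u \in s -> u \in c0 by rewrite -(mem_rot i c0) e inE => ->; rewrite orbT.
case/lastP: s cc mem {e} => [//|[//|a s] b] /andP[/= /andP[va]].
rewrite rcons_path last_rcons => /andP[_ bv] /and3P[_ ab _] mem.
have ea : a = up v by apply: neighbour => //; apply: mem; rewrite mem_head.
have eb : b = up v.
  apply: neighbour; last by rewrite up_adj_sym.
  by apply: mem; rewrite inE mem_rcons mem_head orbT.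
by move: ab; rewrite ea eb mem_rcons mem_head.
Qed.

Definition parent_tree : tree :=
  Tree up_adj_sym up_adj_irr (inhabits v0) up_connected up_acyclic.

End ParentTree.

(** * The tree of a height function and the action of the wreath product on it *)

Section HorocyclicTree.
Variables (F : finGroupType) (A : zmodType) (h : A -> int).
Local Notation lampfun := {fsfun A -> F with 1%g}.
Local Notation G := (wreath F A).

Definition truncate (k : int) (f : lampfun) : lampfun :=
  [fsfun x in finsupp f => if (h x < k)%R then f x else 1%g | 1%g].

Lemma truncateE k f x : truncate k f x = if (h x < k)%R then f x else 1%g.
Proof.
by rewrite fsfun_fun; case: ifPn => // fx; rewrite (fsfun_dflt fx) if_same.
Qed.

(* A coset of the lamp configurations supported on [h >= k], encoded by its
   representative supported on [h < k]. *)
Definition horo_vertex := {kf : int * lampfun | truncate kf.1 kf.2 == kf.2}.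

Definition horo_level (v : horo_vertex) : int := (val v).1.
Definition horo_lamps (v : horo_vertex) : lampfun := (val v).2.

Lemma truncate_idem k f : truncate k (truncate k f) == truncate k f.
Proof. by apply/eqP/fsfunP => x; rewrite !truncateE /=; case: ifP => [->|]. Qed.

Definition horo k f : horo_vertex := Sub (k, truncate k f) (truncate_idem k f).

Lemma horo_lamps_horo k f x : horo_lamps (horo k f) x = if (h x < k)%R then f x else 1%g.
Proof. exact: truncateE. Qed.

Lemma horo_lamps_above v x : (horo_level v <= h x)%R -> horo_lamps v x = 1%g.
Proof.
case: v => -[k f] /= kf; rewrite /horo_level /horo_lamps /= => kx.
by move: kf => /eqP/fsfunP/(_ x) <-; rewrite truncateE ltNge kx.
Qed.

Lemma horo_vertexP u v : horo_level u = horo_level v ->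
  (forall x, (h x < horo_level u)%R -> horo_lamps u x = horo_lamps v x) -> u = v.
Proof.
move=> ul uv; apply: val_inj; rewrite [LHS]surjective_pairing [RHS]surjective_pairing.
congr pair => //; apply/fsfunP => x; rewrite -/(horo_lamps u) -/(horo_lamps v).
case: (ltP (h x) (horo_level u)) => xu; first exact: uv.
by rewrite !horo_lamps_above// -ul.
Qed.

Definition horo_up (v : horo_vertex) := horo (horo_level v - 1)%R (horo_lamps v).

Lemma horo_level_up v : horo_level (horo_up v) = (horo_level v - 1)%R.
Proof. by []. Qed.

Lemma horo_iter_up n v : horo_level (iter n horo_up v) = (horo_level v - Posz n)%R /\
  forall x, (h x < horo_level v - Posz n)%R ->
    horo_lamps (iter n horo_up v) x = horo_lamps v x.
Proof.
elim: n => [|n [IHl IH]] /=; first by rewrite subr0.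
split=> [|x xn]; first by rewrite horo_level_up IHl; lia.
have xl : (h x < horo_level (iter n horo_up v) - 1)%R by rewrite IHl; lia.
by rewrite horo_lamps_horo xl IH//; lia.
Qed.

Lemma lower_bound_seq (s : seq A) : exists m : int, forall x, x \in s -> (m <= h x)%R.
Proof.
elim: s => [|y s [m ms]]; first by exists 0%R.
exists (Num.min m (h y)) => x; rewrite inE => /predU1P[->|/ms]; lia.
Qed.

(** Below the lowest height in the two finite supports, both truncated configurations are
    trivial. *)
Lemma horo_confluent u v : exists m n, iter m horo_up u = iter n horo_up v.
Proof.
have [k ks] := lower_bound_seq (finsupp (horo_lamps u) ++ finsupp (horo_lamps v)).
pose l := Num.min k (Num.min (horo_level u) (horo_level v)).
exists `|horo_level u - l|, `|horo_level v - l|.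
have [ul uE] := horo_iter_up `|horo_level u - l| u.
have [vl vE] := horo_iter_up `|horo_level v - l| v.
apply: horo_vertexP => [|x]; first by rewrite ul vl /l; lia.
rewrite ul => xl; rewrite uE// vE; last by move: xl; rewrite /l; lia.
have xk : (h x < k)%R by move: xl; rewrite /l; lia.
by rewrite !fsfun_dflt//; apply/negP => xs; have := ks x;
  rewrite mem_cat xs ?orbT => /(_ isT); lia.
Qed.

Definition horo_tree : tree :=
  parent_tree (horo 0 [fsfun with 1%g]) horo_level_up horo_confluent.

Hypothesis hD : forall x y, h (x + y)%R = (h x + h y)%R.

(** Left multiplication on cosets: the representative is taken with zero shift, and [horo] truncates
    the product to the representative at the new level. *)
Definition horo_act (g : G) (v : horo_tree) : horo_tree :=
  horo (horo_level v + h (shift g))%R (lamps (g * Wreath (horo_lamps v) 0%R)%g).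

Lemma horo_act_level g v : horo_level (horo_act g v) = (horo_level v + h (shift g))%R.
Proof. by []. Qed.

Lemma horo_act_lamps g v x : (h x < horo_level v + h (shift g))%R ->
  horo_lamps (horo_act g v) x = (lamps g x * horo_lamps v (x - shift g)%R)%g.
Proof. by move=> xl; rewrite horo_lamps_horo xl; exact: lamps_mul. Qed.

Lemma horo_act1 v : horo_act 1%g v = v.
Proof.
have h0 : h 0%R = 0%R by have := hD 0%R 0%R; rewrite addr0; lia.
apply: horo_vertexP => [|x]; rewrite horo_act_level /= h0 addr0// => xv.
rewrite horo_act_lamps /= ?h0 ?addr0// subr0.
by rewrite (lamps_one F) mul1g.
Qed.

Lemma horo_actM g k v : horo_act (g * k)%g v = horo_act g (horo_act k v).
Proof.
have ls : (horo_level v + h (shift (g * k)%g) =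
    horo_level v + h (shift k) + h (shift g))%R.
  by rewrite shiftM hD; lia.
apply: horo_vertexP => [|x]; rewrite !horo_act_level ls// => xv.
rewrite !horo_act_lamps ?horo_act_level ?ls//.
  by rewrite lampsM mulgA shiftM opprD addrA.
have := hD (x - shift g)%R (shift g); rewrite subrK; lia.
Qed.

Lemma horo_act_up g v : horo_act g (horo_up v) = horo_up (horo_act g v).
Proof.
apply: horo_vertexP => [|x];
  rewrite ?horo_level_up !horo_act_level ?horo_level_up; first lia.
move=> xl; rewrite horo_act_lamps// !horo_lamps_horo.
have := hD (x - shift g)%R (shift g); rewrite subrK => xg.
have -> : (h (x - shift g) < horo_level v - 1)%R by lia.
rewrite horo_act_level (_ : (h x < _)%R); last lia.
rewrite (_ : (h x < _)%R); last lia.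
by apply/esym; exact: (lamps_mul g (Wreath (horo_lamps v) 0%R)).
Qed.

Lemma horo_act_automorphism g : tree_automorphism (horo_act g).
Proof.
have K k v : horo_act k^-1%g (horo_act k v) = v by rewrite -horo_actM mulVg horo_act1.
have inj : injective (horo_act g) by move=> u v e; rewrite -[u](K g) e K.
split; first by exists (horo_act g^-1%g) => v //; rewrite -{1}[g]invgK K.
move=> u v; rewrite /adj /= /up_adj -!horo_act_up.
by rewrite !(inj_eq inj).
Qed.

(** A single tree detects only [h (shift g)]; the vanishing of the whole shift comes from combining
    trees. *)
Lemma horo_act_fixed g v : horo_act g v = v -> h (shift g) = 0%R /\
  (shift g = 0%R -> forall x, (h x < horo_level v)%R -> lamps g x = 1%g).
Proof.
move=> e; have g0 : h (shift g) = 0%R.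
  by have := congr1 horo_level e; rewrite horo_act_level; lia.
split=> // s0 x xv; have := congr1 (fun w => horo_lamps w x) e.
rewrite horo_act_lamps ?g0 ?addr0// s0 subr0 => /(canRL (mulgK _)) ->.
exact: mulgV.
Qed.

End HorocyclicTree.

(** * Factorwise actions on a product of trees *)

Section ProductAction.
Variables (n : nat) (T : 'I_n -> tree) (G : groupType).
Variable f : forall i, G -> T i -> T i.
Arguments f : clear implicits.
Hypotheses (f1 : forall i x, f i 1%g x = x)
  (fM : forall i g h x, f i (g * h)%g x = f i g (f i h x))
  (fA : forall i g, tree_automorphism (f i g)).

Definition product_action (g : G) (x : prod_vertex T) : prod_vertex T :=
  fun i => f i g (x i).

Lemma simplex_image (S : tree) (k : S -> S) B :
  tree_automorphism k -> simplex B -> simplex (k @` B).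
Proof.
move=> [_ kE] [[x ->]|[x [y [xy ->]]]]; first by left; exists (k x); rewrite image_set1.
by right; exists (k x), (k y); rewrite kE image_setU !image_set1.
Qed.

Lemma product_action_cube g C : cube C -> cube (product_action g @` C).
Proof.
move=> [S [Ssim ->]]; exists (fun i => f i g @` S i); split.
  by move=> i; exact: simplex_image.
apply/seteqP; split=> [_ [x Sx <-] i|z Sz] /=; first by exists (x i).
exists (fun i => projT1 (cid2 (Sz i))) => [i|]; first by case: (cid2 (Sz i)).
by apply: prod_vertexP => i; rewrite /product_action; case: (cid2 (Sz i)).
Qed.

Lemma product_action1 x : product_action 1%g x = x.
Proof. by apply: prod_vertexP => i; exact: f1. Qed.

Lemma product_actionM g h x :
  product_action (g * h)%g x = product_action g (product_action h x).
Proof. by apply: prod_vertexP => i; exact: fM. Qed.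

Lemma product_action_acts : acts_on_product product_action.
Proof.
have K g x : product_action g^-1%g (product_action g x) = x.
  by rewrite -product_actionM mulVg product_action1.
split; [|exact: product_action1|exact: product_actionM].
move=> g; split.
  by exists (product_action g^-1%g) => x //; rewrite -{1}[g]invgK K.
move=> C; split=> [/(product_action_cube g^-1%g)|]; last exact: product_action_cube.
rewrite image_comp; congr cube; rewrite -[RHS]image_id; apply: eq_imagel => x _.
exact: K.
Qed.

Lemma product_action_preserves : preserves_factors product_action.
Proof. by move=> g; exists (f ^~ g); split. Qed.

End ProductAction.

Section FourTrees.
Variable F : finGroupType.
Local Notation G := (wreath F (int * int)%type).

Definition height (i : 'I_4) (x : int * int) : int :=
  nth 0%R [:: x.1; - x.1; x.2; - x.2]%R i.

Lemma heightD i x y : height i (x + y)%R = (height i x + height i y)%R.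
Proof. by rewrite /height; case: i => -[|[|[|[|]]]] //= _; lia. Qed.

Lemma finite_supported (s : seq (int * int)) :
  finite_set [set g : G | shift g = 0%R /\ forall x, x \notin s -> lamps g x = 1%g].
Proof.
pose S : {fset int * int} := [fset x in s]%fset.
pose w (u : {ffun S -> F}) : G := Wreath [fsfun x : S => u x | 1%g] 0%R.
apply: (@sub_finite_set _ _ (w @` setT)); last exact/finite_image.
move=> g [g0 gs]; exists [ffun x : S => lamps g (val x)] => //.
apply: wreathP => //= x.
rewrite fsfun_ffun; case: insubP => [y _ <-|]; first by rewrite /= ffunE.
by rewrite inE /= => /gs.
Qed.

(** Heights 0 and 2 force the shift to vanish. A nontrivial lamp has height at least the level in
    every tree, and opposite heights then bound each of its coordinates on both sides. *)
Lemma four_trees_proper :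
  acts_properly (product_action (fun i => @horo_act F _ (height i))).
Proof.
move=> v; pose l i := horo_level (v i).
pose i0 : 'I_4 := @Ordinal 4 0 isT; pose i1 : 'I_4 := @Ordinal 4 1 isT.
pose i2 : 'I_4 := @Ordinal 4 2 isT; pose i3 : 'I_4 := @Ordinal 4 3 isT.
have range (a b : int) : exists s : seq int,
    forall c, (a <= c)%R -> (c <= b)%R -> c \in s.
  exists [seq (a + Posz k)%R | k <- iota 0 `|b - a|.+1] => c ac cb.
  by apply/mapP; exists `|c - a|; rewrite ?mem_iota; lia.
have [s s_mem] := range (l i0) (- l i1)%R; have [t t_mem] := range (l i2) (- l i3)%R.
apply: sub_finite_set (finite_supported [seq (x, y) | x <- s, y <- t]).
move=> g /= gv.
have fixed i := horo_act_fixed (congr1 (fun w : prod_vertex _ => w i) gv).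
have s0 : shift g = 0%R.
  have [e0 _] := fixed i0; have [e2 _] := fixed i2.
  by rewrite [LHS]surjective_pairing; congr pair.
split=> // x; apply: contraNeq => gx.
have lh i : (l i <= height i x)%R.
  rewrite leNgt; apply/negP => xl; have [_ /(_ s0 x xl) gx1] := fixed i.
  by rewrite gx1 eqxx in gx.
have h0 : (l i0 <= x.1)%R := lh i0.
have h1 : (l i1 <= - x.1)%R := lh i1.
have h2 : (l i2 <= x.2)%R := lh i2.
have h3 : (l i3 <= - x.2)%R := lh i3.
by rewrite [x]surjective_pairing; apply: allpairs_f; [apply: s_mem|apply: t_mem]; lia.
Qed.

End FourTrees.

Theorem theorem3p1 (F : finGroupType) (F_nontrivial : (1 < #|F|)%N) :
  (exists (T : 'I_4 -> tree)
          (a : wreath F (int * int)%type -> prod_vertex T -> prod_vertex T),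
      [/\ acts_on_product a, preserves_factors a & acts_properly a]) /\
  (forall (n : nat) (T : 'I_n -> tree),
      (forall i, locally_finite (T i)) ->
      ~ exists a : wreath F (int * int)%type -> prod_vertex T -> prod_vertex T,
          acts_on_product a /\ acts_properly a).
Proof.
split.
  exists (fun i => horo_tree F (height i)).
  exists (product_action (fun i => @horo_act F _ (height i))); split.
  - apply: product_action_acts => i *; [exact: horo_act1 (heightD i) _| |].
      exact: horo_actM (heightD i) _ _ _.
    exact: horo_act_automorphism (heightD i) _.
  - apply: product_action_preserves => i g.
    exact: horo_act_automorphism (heightD i) _.
  - exact: four_trees_proper.
move=> n T lfT [a [act prop]].
have [f f1] : exists f : F, f != 1%g.
  have /card_gt1P[x [y [_ _ xy]]] := F_nontrivial.
  by have [x1|] := eqVneq x 1%g; [exists y; rewrite -x1 eq_sym|exists x].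
exact: no_proper_action f1 lfT act prop.
Qed.
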